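(* Let $\mathbb{F}_q$ be a finite field of characteristic $\neq2,3$ such that $2$ is a non-square in $\mathbb{F}_q$. Let $t\in\mathbb{F}_q$ and let $V$ be the singular surface over $\mathbb{F}_q$ given by $w^2=q_1(y,z)\,q_2(x,z)\,q_3(x,y)$, where $$q_1(y,z)=\left(\tfrac18t^2-\tfrac12t+\tfrac14\right)y^2+(t^2-2t+2)yz+(t^2-4t+2)z^2,$$ $$q_2(x,z)=\left(\tfrac18t^2+\tfrac12t+\tfrac14\right)x^2+(t^2+2t+2)xz+(t^2+4t+2)z^2,$$ $$q_3(x,y)=(x+y)(2x+t^2y).$$ Suppose that $t\neq0$ and $t^2\neq-2$. Then $\#V(\mathbb{F}_q)=q^2+q+1$.
   Context: The surface $V$ is the double cover of $\mathbb{P}^2_{\mathbb{F}_q}$ (homogeneous coordinates $x,y,z$ of weight $1$, and $w$ of weight $3$) defined by the given equation, i.e. a hypersurface in the weighted projective space $\mathbb{P}(1,1,1,3)$; it is not desingularized. *)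

(* Defs.v *)
From HB Require Import structures.
From mathcomp Require Import all_boot all_order all_algebra.

Set Implicit Arguments.
Unset Strict Implicit.
Unset Printing Implicit Defensive.

Import GRing.Theory.
Local Open Scope ring_scope.

Section WeightedProjective.

Variable F : finFieldType.

(* Affine coordinates (x, y, z, w), of weights 1, 1, 1, 3. *)
Definition coords : finType := (F * F * F * F)%type.

Definition wscale (l : F) (p : coords) : coords :=
  let: (x, y, z, w) := p in (l * x, l * y, l * z, l ^+ 3 * w).

Definition wequiv : rel coords :=
  [rel p p' | [exists l : F, (l != 0) && (p' == wscale l p)]].

Lemma wequiv_equivalence : equivalence_rel wequiv.
Proof.
have scale1 p : wscale 1 p = p.
  by case: p => [[[x y] z] w] /=; rewrite expr1n !mul1r.
have scaleM l m p : wscale l (wscale m p) = wscale (l * m) p.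
  by case: p => [[[x y] z] w] /=; rewrite exprMn !mulrA.
have wsym p p' : wequiv p p' -> wequiv p' p.
  case/existsP=> l /andP[l0 /eqP->]; apply/existsP; exists l^-1.
  by rewrite invr_eq0 l0 scaleM mulVf // scale1 eqxx.
have wtrans p p' p'' : wequiv p p' -> wequiv p' p'' -> wequiv p p''.
  case/existsP=> l /andP[l0 /eqP->] /existsP[m /andP[m0 /eqP->]].
  by apply/existsP; exists (m * l); rewrite mulf_neq0 //= scaleM.
move=> p p' p''; split.
  by apply/existsP; exists 1; rewrite oner_eq0 scale1 eqxx.
move=> pp'; apply/idP/idP; last exact: wtrans.
by apply: wtrans; apply: wsym.
Qed.

(* The F-rational points of the hypersurface w^2 = f(x, y, z) in P(1,1,1,3),
   for f homogeneous of degree 6: each one is the F^*-orbit of a nonzero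
   solution over F.  Orbits under F^* and under the multiplicative group of an
   algebraic closure identify the same solutions over F, because the equation
   excludes (0:0:0:1): one of the weight 1 coordinates x, y, z is nonzero. *)
Definition double_plane_cone (f : F -> F -> F -> F) : {set coords} :=
  [set p : coords | let: (x, y, z, w) := p in
     (p != (0, 0, 0, 0)) && (w ^+ 2 == f x y z)].

Definition double_plane_points (f : F -> F -> F -> F) : {set {set coords}} :=
  equivalence_partition wequiv (double_plane_cone f).

End WeightedProjective.

Section Surface.

Variables (F : finFieldType) (t : F).

Definition q1 (y z : F) : F :=
  (1 / 8 * t ^+ 2 - 1 / 2 * t + 1 / 4) * y ^+ 2
  + (t ^+ 2 - 2 * t + 2) * y * z + (t ^+ 2 - 4 * t + 2) * z ^+ 2.

Definition q2 (x z : F) : F :=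
  (1 / 8 * t ^+ 2 + 1 / 2 * t + 1 / 4) * x ^+ 2
  + (t ^+ 2 + 2 * t + 2) * x * z + (t ^+ 2 + 4 * t + 2) * z ^+ 2.

Definition q3 (x y : F) : F := (x + y) * (2 * x + t ^+ 2 * y).

Definition V_points : {set {set coords F}} :=
  double_plane_points (fun x y z => q1 y z * q2 x z * q3 x y).

End Surface.

(* Main.v *)
(* Let chi be the quadratic character of F_q.  Since V has q^2 + q + 1 + S
   points, S being the sum of chi(q1 q2 q3) over P^2(F_q), one has to show
   S = 0.  Put x = 1 - Y, y = 1 + Y, k = (t^2 + 2) / (t^2 - 2); then
   q3 = 2 (t^2 - 2) (k + Y).  As q1 has no root, the sum over z of chi(q1 q2) is
   a sum over the values m of q2 / q1, each taken 1 + chi(disc(q2 - m q1))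
   times, and it becomes, up to an additive constant, minus the sum over m of
   chi(m (m + P) (m + Q)) with P = 1 - Y^2 and Q = 1 - (k^2 - Y^2).  This is a
   function of Y^2 invariant under Y^2 |-> k^2 - Y^2.  On the circle
   Y^2 + Z^2 = k^2 one has 2 (k + Y) (k + Z) = (k + Y + Z)^2, and chi(2) = -1,
   so exchanging Y and Z changes the sign of chi(k + Y) and S = 0. *)
Require Import Defs.
From mathcomp Require Import all_boot all_order all_algebra ring zify.

Set Implicit Arguments.
Unset Strict Implicit.
Unset Printing Implicit Defensive.

Import GRing.Theory.
Local Open Scope ring_scope.

(** * Quadratic character sums over a finite field of odd characteristic *)

Section QuadraticCharacter.

Variable F : finFieldType.
Implicit Types x y z m : F.

Definition chi x : int :=
  if x == 0 then 0 else if [exists y, y ^+ 2 == x] then 1 else -1.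

Lemma chi0 : chi 0 = 0.
Proof. by rewrite /chi eqxx. Qed.

Lemma chi_sqr x : x != 0 -> chi (x ^+ 2) = 1.
Proof.
move=> x0; rewrite /chi expf_eq0 /= (negbTE x0).
by rewrite (_ : [exists y, _]) //; apply/existsP; exists x.
Qed.

Lemma chi_nonsquare x : ~ (exists y, y ^+ 2 = x) -> chi x = -1.
Proof.
move=> nx; rewrite /chi; case: eqP => [x0|_].
  by case: nx; exists 0; rewrite x0 expr0n.
by case: existsP => // -[y /eqP yx]; case: nx; exists y.
Qed.

Lemma chi_sqrt x : chi x = 1 -> exists2 y, y != 0 & x = y ^+ 2.
Proof.
rewrite /chi; case: eqP => // /eqP x0; case: existsP => // -[y /eqP yx] _.
by exists y => //; apply: contraNneq x0 => y0; rewrite -yx y0 expr0n.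
Qed.

Lemma chi_cases x : [\/ x = 0, chi x = 1 | chi x = -1].
Proof.
rewrite /chi; case: eqP => [->|_]; first exact: Or31.
by case: ifP => _; [exact: Or32|exact: Or33].
Qed.

Hypothesis two_neq0 : 2 != 0 :> F.

Lemma card_sqrt x : \sum_w (w ^+ 2 == x)%:R = 1 + chi x.
Proof.
case: (chi_cases x) => [->|/chi_sqrt[y y0 ->]|cx].
- rewrite chi0 addr0 (bigD1 0) //= expr0n eqxx big1 ?addr0 // => w w0.
  by rewrite expf_eq0 /= (negbTE w0).
- have yN : - y != y.
    by rewrite -subr_eq0 -opprD oppr_eq0 -mulr2n -mulr_natl mulf_neq0.
  rewrite chi_sqr // (bigD1 y) //= (bigD1 (- y)) //= sqrrN !eqxx big1 //.
  move=> w /andP[wy wNy]; rewrite eqf_sqr (negbTE wy) (negbTE wNy).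
  by [].
- rewrite cx big1 // => w _; case: eqP => // wx; move: cx; rewrite -wx.
  case: (eqVneq w 0) => [->|/chi_sqr->//].
  by rewrite expr0n chi0.
Qed.

Lemma sum_chi : \sum_x chi x = 0.
Proof.
have -> : \sum_x chi x = \sum_x (1 + chi x) - \sum_(x : F) 1.
  by rewrite big_split /= addrAC subrr add0r.
under eq_bigr do rewrite -card_sqrt.
rewrite exchange_big /= -sumrB big1 // => w _.
rewrite (bigD1 (w ^+ 2)) //= eqxx big1 ?addr0 ?subrr // => x.
by rewrite eq_sym => /negbTE->.
Qed.

(* For a nonsquare [x], [y |-> chi (x * y) + chi y] is nonpositive with
   vanishing sum, hence zero. *)
Lemma chiM : {morph chi : x y / x * y}.
Proof.
have sqM u y : u != 0 -> chi (u ^+ 2 * y) = chi y.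
  move=> u0; case: (chi_cases y) => [->|/chi_sqrt[v v0 ->]|cy].
  - by rewrite mulr0.
  - by rewrite -exprMn !chi_sqr // mulf_neq0.
  - rewrite cy; apply: chi_nonsquare => -[v vE]; move: cy.
    have -> : y = (u^-1 * v) ^+ 2.
      by rewrite exprMn vE exprVn mulKf // expf_neq0.
    case: (eqVneq (u^-1 * v) 0) => [->|/chi_sqr->//].
    by rewrite expr0n chi0.
move=> x y; case: (chi_cases x) => [->|/chi_sqrt[u u0 ->]|cx].
- by rewrite mul0r chi0 mul0r.
- by rewrite sqM // chi_sqr // mul1r.
have x0 : x != 0 by apply: contra_eq_neq cx => ->; rewrite chi0.
have le0 z : 0 <= - (chi (x * z) + chi z).
  case: (chi_cases z) => [->|/chi_sqrt[v v0 ->]|->].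
  - by rewrite mulr0 chi0.
  - by rewrite mulrC sqM // cx chi_sqr.
  - by rewrite /chi; case: ifP => // _; case: ifP.
have /eqP : \sum_z - (chi (x * z) + chi z) = 0.
  have s0 : \sum_z chi (x * z) = 0.
    by rewrite -[RHS]sum_chi [RHS](reindex_inj (mulfI x0)).
  by rewrite sumrN big_split /= sum_chi s0 addr0 oppr0.
rewrite Num.Theory.psumr_eq0 // => /allP/(_ y (mem_index_enum y)).
by rewrite oppr_eq0 addr_eq0 cx mulN1r => /eqP.
Qed.

Lemma chi_mul_sqr x y : x != 0 -> chi (x ^+ 2 * y) = chi y.
Proof. by move=> x0; rewrite chiM chi_sqr // mul1r. Qed.

Lemma sum_chi_affine a b : a != 0 -> \sum_x chi (a * x + b) = 0.
Proof.
move=> a0; rewrite -[RHS]sum_chi [RHS](reindex_inj (addIr b)) /=.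
by rewrite [RHS](reindex_inj (mulfI a0)).
Qed.

(** For [a != 0], completing the square turns roots into square roots of the discriminant. For
    [a = 0] the discriminant is [b ^+ 2], whose character tells whether the remaining affine
    equation has a root. *)
Lemma card_quadratic_roots (a b c : F) : [|| a != 0, b != 0 | c != 0] ->
  \sum_z (a * z ^+ 2 + b * z + c == 0)%:R
  = 1 + chi (b ^+ 2 - 4 * a * c) - (a == 0)%:R.
Proof.
case: (eqVneq a 0) => [->/=|a0 _].
  rewrite !(mulr0, mul0r) subr0 addrC addKr.
  case: (eqVneq b 0) => [->/= c0|b0 _].
    rewrite expr0n chi0 big1 // => z _.
    by rewrite !mul0r !add0r (negbTE c0).
  rewrite chi_sqr // (bigD1 (- c / b)) //= mul0r add0r mulrC divfK //.
  rewrite addNr eqxx big1 ?addr0 // => z zN.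
  rewrite mul0r add0r addr_eq0; case: eqP => // bz.
  by rewrite -bz mulrC mulKf // eqxx in zN.
rewrite subr0 -card_sqrt.
have ta0 : 2 * a != 0 by rewrite mulf_neq0.
rewrite [RHS](reindex_inj (addIr b)) /= [RHS](reindex_inj (mulfI ta0)) /=.
apply: eq_bigr => z _; congr ((_ : bool)%:R).
rewrite -[RHS]subr_eq0.
have -> : (2 * a * z + b) ^+ 2 - (b ^+ 2 - 4 * a * c)
          = 2 ^+ 2 * a * (a * z ^+ 2 + b * z + c) by ring.
by rewrite mulf_eq0 mulf_eq0 expf_eq0 (negbTE a0) (negbTE two_neq0).
Qed.

(* The fibres of [z |-> h(z) / g(z)] are counted by the discriminant of
   [h - m g]; the last term is the contribution of [z] at infinity. *)
Lemma sum_chi_quadratic2 (a2 a1 a0 c2 c1 c0 : F) :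
  a2 != 0 -> (forall z, a2 * z ^+ 2 + a1 * z + a0 != 0) ->
  (forall m, [|| c2 - m * a2 != 0, c1 - m * a1 != 0 | c0 - m * a0 != 0]) ->
  \sum_z chi ((a2 * z ^+ 2 + a1 * z + a0) * (c2 * z ^+ 2 + c1 * z + c0))
  = \sum_m chi (m * ((c1 - m * a1) ^+ 2 - 4 * (c2 - m * a2) * (c0 - m * a0)))
    - chi (a2 * c2).
Proof.
move=> a20 g0 nprop.
transitivity (\sum_m \sum_z
  ((c2 - m * a2) * z ^+ 2 + (c1 - m * a1) * z + (c0 - m * a0) == 0)%:R * chi m).
  rewrite exchange_big /=; apply: eq_bigr => z _.
  set g := a2 * _ + _ + _; set h := c2 * _ + _ + _.
  have gE m : (c2 - m * a2) * z ^+ 2 + (c1 - m * a1) * z + (c0 - m * a0)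
              = h - m * g by rewrite /g /h; ring.
  have gz : g != 0 := g0 z.
  rewrite (bigD1 (h / g)) //= gE divfK // subrr eqxx mul1r big1 => [|m mN].
    rewrite addr0 -(chi_mul_sqr (h / g) gz).
    by congr (chi _); field.
  rewrite gE subr_eq0; case: eqP => [hE|_]; last by rewrite mul0r.
  by rewrite hE mulfK ?eqxx // in mN.
under eq_bigr => m _ do
  rewrite -mulr_suml card_quadratic_roots // mulrBl mulrDl mul1r.
rewrite sumrB big_split /= sum_chi add0r; congr (_ - _).
  by apply: eq_bigr => m _; rewrite mulrC -chiM.
(* Only [m = c2 / a2] makes the leading coefficient of [h - m g] vanish. *)
rewrite (bigD1 (c2 / a2)) //= divfK // subrr eqxx mul1r big1 => [|m mN].
  rewrite addr0 -(chi_mul_sqr (c2 / a2) a20).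
  by congr (chi _); field.
rewrite subr_eq0; case: eqP => [cE|_]; last by rewrite mul0r.
by rewrite cE mulfK ?eqxx // in mN.
Qed.

(* [m (m^2 - e m + 1) = m^2 (m + 1/m - e)], and [m + 1/m = n] has
   [1 + chi (n^2 - 4)] solutions. *)
Lemma sum_chi_reciprocal (e : F) :
  \sum_m chi (m * (m ^+ 2 - e * m + 1)) = \sum_n chi ((n - e) * (n ^+ 2 - 4)).
Proof.
transitivity (\sum_n \sum_m
   (1 * m ^+ 2 + (- n) * m + 1 == 0)%:R * chi (n - e)).
  rewrite exchange_big /=; apply: eq_bigr => m _.
  case: (eqVneq m 0) => [->|m0].
    rewrite mul0r chi0 big1 // => n _.
    by rewrite expr0n /= !mulr0 !add0r oner_eq0 mul0r.
  have nE n : (1 * m ^+ 2 + (- n) * m + 1 == 0) = (n == m + m^-1).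
    rewrite -[RHS](inj_eq (mulIf m0)) mulrDl mulVf //.
    rewrite -[RHS]subr_eq0 -[RHS]oppr_eq0.
    by congr (_ == 0); ring.
  rewrite (bigD1 (m + m^-1)) //= nE eqxx big1 => [|n nN].
    rewrite mul1r addr0 -(chi_mul_sqr (m + m^-1 - e) m0).
    by congr (chi _); field.
  by rewrite nE (negbTE nN) mul0r.
under eq_bigr => n _ do
  rewrite -mulr_suml card_quadratic_roots ?oner_eq0 // subr0 mulrDl mul1r.
rewrite big_split /= -[X in _ = X]add0r; congr (_ + _).
  rewrite -[RHS](sum_chi_affine (a := 1) (- e)) ?oner_eq0 //.
  by under [RHS]eq_bigr do rewrite mul1r.
by apply: eq_bigr => n _; rewrite mulrC -chiM sqrrN !mulr1.
Qed.

(* On the circle [Y^2 + Z^2 = k^2] one has [2 (k + Y) (k + Z) = (k + Y + Z)^2],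
   so for a nonsquare 2 the symmetry [Y <-> Z] changes the sign of
   [chi (k + Y)]. *)
Lemma sum_chi_circle (k : F) (f : F -> int) :
  chi 2 = -1 -> k != 0 -> (forall v, f (k ^+ 2 - v) = f v) ->
  \sum_y chi (k + y) * f (y ^+ 2) = 0.
Proof.
move=> chi2 k0 fsym; set S := \sum_y _.
(* A weighted sum over the points [(y, z)] of the circle, evaluated in two ways. *)
pose C :=
  \sum_y \sum_z (z ^+ 2 == k ^+ 2 - y ^+ 2)%:R * (chi (k + y) * f (y ^+ 2)).
have CE : C = S + S + chi k * f (k ^+ 2).
  rewrite /C; under eq_bigr => y _ do rewrite -mulr_suml card_sqrt mulrDl mul1r.
  rewrite big_split /= -addrA; congr (_ + _).
  rewrite /S [X in _ = X + _](reindex_inj oppr_inj) /=.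
  (* Off [y = - k], [chi (k + y) * chi (k ^+ 2 - y ^+ 2)] is [chi (k - y)]. At [y = - k] the product
     is 0 but [chi (k - y) = chi (2 * k) = - chi k]; this term makes up for it. *)
  have -> : chi k * f (k ^+ 2) =
      \sum_y (y == - k)%:R * (chi k * f (y ^+ 2)).
    rewrite (bigD1 (- k)) //= eqxx mul1r sqrrN big1 ?addr0 // => y /negbTE->.
    by rewrite mul0r.
  rewrite -big_split /=; apply: eq_bigr => y _.
  rewrite sqrrN !mulrA -!mulrDl; congr (_ * _).
  case: (eqVneq y (- k)) => [->|yNk].
    rewrite sqrrN subrr chi0 mul0r opprK mul1r -mulr2n -mulr_natl chiM chi2.
    by rewrite mulN1r addNr.
  have ky : k + y != 0 by rewrite addrC addr_eq0.
  by rewrite mul0r addr0 -chiM mulrC subr_sqr mulrCA -expr2 mulrC chi_mul_sqr.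
(* Adding the sum with [y] and [z] exchanged cancels every point of the circle except [(- k, 0)] and
   [(0, - k)], where one of [k + y], [k + z] is 0 and the other is [k]. *)
have CE' : C + C = chi k * f (k ^+ 2) + chi k * f (k ^+ 2).
  rewrite {2}/C exchange_big /= /C -big_split /=.
  under eq_bigr => y _ do rewrite -big_split /=.
  have -> : chi k * f (k ^+ 2) + chi k * f (k ^+ 2) =
     \sum_y \sum_z ((y == - k)%:R * (z == 0)%:R + (y == 0)%:R * (z == - k)%:R)
       * (chi k * f (y ^+ 2)).
    have delta (a b : F) : \sum_y \sum_z ((y == a)%:R * (z == b)%:R)
       * (chi k * f (y ^+ 2)) = chi k * f (a ^+ 2).
      rewrite (bigD1 a) //= (bigD1 b) //= !eqxx !mul1r.
      rewrite !big1 ?addr0 // => [y /negbTE->|z /negbTE->].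
        by rewrite big1 // => z _; rewrite !mul0r.
      by rewrite mulr0 mul0r.
    have fk : f (k ^+ 2) = f (0 ^+ 2) by rewrite -fsym expr0n subrr.
    rewrite -{1}(sqrrN k) fk -(delta (- k) 0).
    rewrite -(delta 0 (- k)) -big_split; apply: eq_bigr => y _.
    by rewrite -big_split; apply: eq_bigr => z _; rewrite mulrDl.
  apply: eq_bigr => y _; apply: eq_bigr => z _.
  have -> : (y ^+ 2 == k ^+ 2 - z ^+ 2) = (z ^+ 2 == k ^+ 2 - y ^+ 2).
    by rewrite -subr_eq0 -[RHS]subr_eq0; congr (_ == 0); ring.
  case: (eqVneq (z ^+ 2) (k ^+ 2 - y ^+ 2)) => [zE|zN]; last first.
    have -> : (y == - k)%:R * (z == 0%R)%:R = 0%R :> int.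
      case: eqP => [yk|_]; last by rewrite mul0r.
      case: eqP => [z0|_]; last by rewrite mulr0.
      by move: zN; rewrite yk z0 sqrrN expr0n subrr eqxx.
    have -> : (y == 0%R)%:R * (z == - k)%:R = 0%R :> int.
      case: eqP => [y0|_]; last by rewrite mul0r.
      case: eqP => [zk|_]; last by rewrite mulr0.
      by move: zN; rewrite y0 zk sqrrN expr0n subr0 eqxx.
    by rewrite !mul0r ?addr0 ?mul0r.
  rewrite !mul1r zE fsym -mulrDl mulrA; congr (_ * _).
  have kyz : (k + y + z) ^+ 2 = 2 * ((k + y) * (k + z)).
    by rewrite sqrrD zE; ring.
  case: (eqVneq y (- k)) => [yk|yNk].
    move/eqP: zE; rewrite yk sqrrN subrr expf_eq0 /= => /eqP->.
    rewrite oppr_eq0 (negbTE k0) eqxx subrr chi0 add0r addr0.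
    by rewrite mul1r mul0r addr0 mul1r.
  rewrite mul0r add0r.
  case: (eqVneq z (- k)) => [zk|zNk].
    have /eqP : y ^+ 2 = 0 by rewrite -[LHS](subKr (k ^+ 2)) -zE zk sqrrN subrr.
    rewrite expf_eq0 /= => /eqP->.
    by rewrite zk subrr chi0 eqxx !addr0 !mul1r.
  rewrite mulr0 mul0r; apply/eqP.
  have ky : k + y != 0 by rewrite addrC addr_eq0.
  have kz : k + z != 0 by rewrite addrC addr_eq0.
  have : chi (2 * ((k + y) * (k + z))) = 1.
    by rewrite -kyz chi_sqr // -[_ == 0](expf_eq0 _ 2) kyz !mulf_neq0.
  rewrite !chiM chi2 mulN1r addr_eq0.
  case: (chi_cases (k + y)) => [/eqP|->|->]; first by rewrite (negbTE ky).
    by rewrite mul1r => ->.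
  by rewrite mulN1r opprK => ->.
have : (S + S) + (S + S) = 0 by move: CE'; rewrite CE; lia.
lia.
Qed.

End QuadraticCharacter.

(** * From points of the double plane to a character sum *)

Section PointCount.

Variables (F : finFieldType) (f : F -> F -> F -> F).
Hypothesis two_neq0 : 2 != 0 :> F.
Hypothesis f_homogeneous :
  forall l x y z, f (l * x) (l * y) (l * z) = l ^+ 6 * f x y z.

Lemma wscale_cone (l : F) p : l != 0 ->
  p \in double_plane_cone f -> wscale l p \in double_plane_cone f.
Proof.
move=> l0; case: p => [[[x y] z] w]; rewrite !inE /= => /andP[p0 /eqP pf].
rewrite f_homogeneous exprMn -exprM pf eqxx andbT.
apply: contraNneq p0 => -[/eqP + /eqP + /eqP + /eqP].
rewrite !mulf_eq0 (negbTE l0) /=.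
by move=> /eqP-> /eqP-> /eqP-> /eqP->.
Qed.

(** Since [f 0 0 0 = 0], a point of the cone has a nonzero coordinate of weight 1, from which the
    scalar can be read off. Hence all orbits have [#|F|.-1] elements. *)
Lemma wscale_inj p : p \in double_plane_cone f ->
  injective (fun l : F => wscale l p).
Proof.
case: p => [[[x y] z] w]; rewrite inE => /andP[p0 /eqP pf] l m /= [lx ly lz _].
have [x0|/mulIf/(_ _ _ lx)//] := eqVneq x 0.
have [y0|/mulIf/(_ _ _ ly)//] := eqVneq y 0.
have [z0|/mulIf/(_ _ _ lz)//] := eqVneq z 0.
case/negP: p0; rewrite x0 y0 z0; move/eqP: pf; rewrite x0 y0 z0.
have := f_homogeneous 0 0 0 0; rewrite !mul0r expr0n mul0r => ->.
by rewrite expf_eq0 /= => /eqP->.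
Qed.

Lemma card_cone_orbits :
  #|double_plane_cone f| = (#|double_plane_points f| * #|F|.-1)%N.
Proof.
have eqv : {in double_plane_cone f & &, equivalence_rel (@wequiv F)}.
  by move=> p p' p'' _ _ _; apply: wequiv_equivalence.
apply: card_uniform_partition (equivalence_partitionP eqv) => A.
case/imsetP=> p pC ->.
transitivity #|[set wscale l p | l in predC1 (0 : F)]|.
  apply: eq_card => p'; rewrite inE; apply/andP/imsetP.
    by case=> _ /existsP[l /andP[l0 /eqP->]]; exists l; rewrite ?inE.
  case=> l; rewrite inE => l0 ->; split; first exact: wscale_cone.
  by apply/existsP; exists l; rewrite l0 eqxx.
rewrite card_imset; last exact: wscale_inj.
by rewrite cardC1.
Qed.

(** Above each [(x, y, z)] lie [1 + chi (f x y z)] values of [w]; the [- 1] removes the origin. *)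
Lemma card_cone :
  (#|double_plane_cone f|%:Z = #|F|%:Z ^+ 3 - 1
    + \sum_x \sum_y \sum_z chi (f x y z))%R.
Proof.
have f0 : f 0 0 0 = 0.
  by have := f_homogeneous 0 0 0 0; rewrite !mul0r expr0n mul0r.
pose D : {set coords F} :=
  [set p | let: (x, y, z, w) := p in w ^+ 2 == f x y z].
have -> : double_plane_cone f = D :\ (0, 0, 0, 0).
  by apply/setP => -[[[x y] z] w]; rewrite !inE.
have oD : (0, 0, 0, 0) \in D by rewrite inE f0 expr0n.
have -> : #|D :\ (0, 0, 0, 0)|%:Z = #|D|%:Z - 1.
  by rewrite (cardsD1 (0, 0, 0, 0) D) oD PoszD addrC addKr.
rewrite addrAC; congr (_ - 1).
transitivity (\sum_x \sum_y \sum_z (1 + chi (f x y z))).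
  under eq_bigr do under eq_bigr do
    under eq_bigr do rewrite -(card_sqrt two_neq0).
  rewrite -sum1_card pair_big pair_big pair_big /=.
  rewrite -natr_sum big_mkcond /= -[LHS]natz; congr (_%:R).
  by apply: eq_bigr => -[[[x y] z] w] _; rewrite inE /=; case: (_ == _).
under eq_bigr do under eq_bigr do rewrite big_split /=.
under eq_bigr do rewrite big_split /=.
rewrite big_split /=; congr (_ + _).
by rewrite !sumr_const -!mulrnA -[X in X ^+ 3]natz -natrX !expnS muln1 mulnA.
Qed.

(* Coordinates [x = l (1 - Y), y = l (1 + Y)] off the line [x + y = 0]. *)
Lemma sum_chi_homogeneous : (forall x z, f x (- x) z = 0) ->
  \sum_x \sum_y \sum_z chi (f x y z)
  = (#|F|.-1)%:R * \sum_Y \sum_z chi (f (1 - Y) (1 + Y) z).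
Proof.
move=> fN; pose g x y := \sum_z chi (f x y z).
transitivity (\sum_l \sum_m g (l - m) (l + m)).
  transitivity (\sum_x \sum_l g x (2 * l - x)).
    apply: eq_bigr => x _.
    by rewrite (reindex_inj (addIr (- x))) (reindex_inj (mulfI two_neq0)).
  rewrite exchange_big; apply: eq_bigr => l _.
  rewrite (reindex_inj (subrI l)); apply: eq_bigr => m _.
  by congr g; ring.
rewrite (bigD1 0) //= big1 => [|m _]; last first.
  by rewrite sub0r add0r /g big1 // => z _; rewrite -{2}[m]opprK fN chi0.
rewrite add0r mulr_natl -(cardC1 (0 : F)) -sumr_const.
(* Putting [m = l Y] and scaling [z] by [l] multiplies [f] by [l ^+ 6], the square of [l ^+ 3]. *)
apply: eq_bigr => l l0; rewrite (reindex_inj (mulfI l0)).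
apply: eq_bigr => Y _; rewrite /g (reindex_inj (mulfI l0)).
apply: eq_bigr => z _.
rewrite -{1 3}[l]mulr1 -mulrBr -mulrDr f_homogeneous.
by rewrite (exprM l 3 2) (chi_mul_sqr two_neq0) // expf_neq0.
Qed.

End PointCount.

(** * The character sum of the surface *)

Section Surface.

Variables (F : finFieldType) (t : F).
Hypothesis two_neq0 : 2 != 0 :> F.
Hypothesis two_nonsquare : ~ exists a : F, a ^+ 2 = 2.
Hypothesis t_neq0 : t != 0.
Hypothesis t2_neqN2 : t ^+ 2 != - 2.

Lemma sqr_eq_2sqr (a b : F) : a ^+ 2 = 2 * b ^+ 2 -> b = 0.
Proof.
move=> ab; apply/eqP/negPn/negP => b0; apply: two_nonsquare.
by exists (a / b); rewrite exprMn ab exprVn mulfK // expf_neq0.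
Qed.

Lemma chi2 : chi (2 : F) = -1.
Proof. exact: chi_nonsquare. Qed.

Lemma four_neq0 : 4 != 0 :> F.
Proof. by rewrite -[4%N]/(2 * 2)%N natrM mulf_neq0. Qed.

Lemma eight_neq0 : 8 != 0 :> F.
Proof. by rewrite -[8%N]/(2 * 4)%N natrM mulf_neq0 // four_neq0. Qed.

Let nz := (two_neq0, four_neq0, eight_neq0).

(** Coefficients of the forms: [q1] is [b1 / 8, a1, b1] and [q2] is [b2 / 8, a2, b2]. The sign
    change of [t] exchanges the indices 1 and 2. *)
Let s := t ^+ 2 + 2.
Let a1 := s - 2 * t.
Let b1 := s - 4 * t.
Let a2 := s + 2 * t.
Let b2 := s + 4 * t.
Let d := t ^+ 2 - 2.
Let k := s / d.

Lemma q1E y z : q1 t y z = b1 * z ^+ 2 + (a1 * y) * z + b1 / 8 * y ^+ 2.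
Proof. by rewrite /q1 /a1 /b1 /s; field; rewrite ?nz. Qed.

Lemma q2E x z : q2 t x z = b2 * z ^+ 2 + (a2 * x) * z + b2 / 8 * x ^+ 2.
Proof. by rewrite /q2 /a2 /b2 /s; field; rewrite ?nz. Qed.

Lemma s_neq0 : s != 0.
Proof. by rewrite /s addr_eq0. Qed.

Lemma d_neq0 : d != 0.
Proof.
rewrite /d subr_eq0; apply/eqP => t2; apply: two_nonsquare.
by exists t.
Qed.

(** [b1 = (t - 2) ^+ 2 - 2], and 2 is not a square. *)
Lemma b1_neq0 : b1 != 0.
Proof.
apply/eqP => b10; have /eqP : (1 : F) = 0.
  apply: (@sqr_eq_2sqr (t - 2)); apply/eqP; rewrite -subr_eq0; apply/eqP.
  by rewrite -b10 /b1 /s; ring.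
by rewrite oner_eq0.
Qed.

Lemma b2_neq0 : b2 != 0.
Proof.
apply/eqP => b20; have /eqP : (1 : F) = 0.
  apply: (@sqr_eq_2sqr (t + 2)); apply/eqP; rewrite -subr_eq0; apply/eqP.
  by rewrite -b20 /b2 /s; ring.
by rewrite oner_eq0.
Qed.

(* The discriminant [a1^2 - b1^2 / 2] of [q1] is [d^2 / 2], a nonsquare. *)
Lemma q1_neq0 y z : y != 0 -> q1 t y z != 0.
Proof.
move=> y0; apply/eqP => q10; have /eqP : d * y / 2 = 0.
  apply: (@sqr_eq_2sqr (2 * b1 * z + a1 * y)); apply/eqP.
  rewrite -subr_eq0; apply/eqP; transitivity (4 * b1 * q1 t y z).
    by rewrite q1E /d /a1 /b1 /s; field; rewrite ?nz.
  by rewrite q10 mulr0.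
by rewrite !mulf_eq0 invr_eq0 (negbTE d_neq0) (negbTE y0) (negbTE two_neq0).
Qed.

(** When the cubic is separable, this is minus the trace of Frobenius of the elliptic curve
    [w^2 = m (m + p) (m + q)]. *)
Definition cubic_sum (p q : F) : int := \sum_m chi (m * (m + p) * (m + q)).

Lemma cubic_sumC p q : cubic_sum p q = cubic_sum q p.
Proof. by apply: eq_bigr => m _; rewrite -mulrA [X in m * X]mulrC mulrA. Qed.

Lemma cubic_sum0 q : cubic_sum 0 q = - chi q.
Proof.
have -> : - chi q = \sum_m chi (m + q) - chi q.
  have -> : \sum_m chi (m + q) = \sum_m chi (1 * m + q).
    by apply: eq_bigr => m _; rewrite mul1r.
  by rewrite sum_chi_affine ?oner_eq0 // add0r.
rewrite (bigD1 0) //= add0r [X in X - _]addrC addrK /cubic_sum.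
rewrite (bigD1 0) //= !mul0r chi0 add0r; apply: eq_bigr => m m0.
by rewrite addr0 -expr2 chi_mul_sqr.
Qed.

(* [z |-> 1 / (2 z)] multiplies the summand by a nonsquare. *)
Lemma sum_chi_degenerate (a b c : F) :
  \sum_z chi (c * z ^+ 2 * (a * z ^+ 2 + b * z + a / 2)) = 0.
Proof.
set S := \sum_z _; suff : S = - S by lia.
rewrite {1}/S (reindex_inj (can_inj invrK)) (reindex_inj (mulfI two_neq0)).
rewrite -sumrN; apply: eq_bigr => z _.
(* As [0^-1 = 0], the substitution fixes [z = 0], where the summand vanishes. *)
case: (eqVneq z 0) => [->|z0].
  by rewrite mulr0 invr0 expr0n mulr0 !mul0r chi0 oppr0.
set r := c * z ^+ 2 * _.
have -> : c * (2 * z)^-1 ^+ 2 *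
    (a * (2 * z)^-1 ^+ 2 + b * (2 * z)^-1 + a / 2)
  = ((4 * z ^+ 3)^-1) ^+ 2 * (2 * r).
  by rewrite /r; field; rewrite z0 ?nz.
by rewrite (chi_mul_sqr two_neq0) ?(chiM two_neq0) ?chi2 ?mulN1r //
  invr_eq0 mulf_neq0 ?expf_neq0 ?nz.
Qed.

(** At [Y = 1] or [Y = - 1] one form degenerates to a multiple of [z ^+ 2] and both sides are 0.
    Otherwise [sum_chi_quadratic2] and [sum_chi_reciprocal] lead to the cubic. *)
Lemma sum_chi_q1q2 Y :
  \sum_z chi (q1 t (1 + Y) z * q2 t (1 - Y) z)
  = - cubic_sum (1 - Y ^+ 2) (1 - (k ^+ 2 - Y ^+ 2)) - chi (b1 * b2).
Proof.
have d0 := d_neq0.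
(* [2 - k ^+ 2 = b1 * b2 / d ^+ 2], because [d ^+ 2 = s ^+ 2 - 8 * t ^+ 2]. *)
have k2 : chi (1 - (k ^+ 2 - 1)) = chi (b1 * b2).
  rewrite -[RHS](chi_mul_sqr two_neq0 (x := d^-1)) ?invr_eq0 //.
  by congr (chi _); rewrite /k /b1 /b2 /s; move: d0; rewrite /d => d0; field.
case: (eqVneq Y 1) => [->|Y1].
  rewrite expr1n subrr cubic_sum0 k2 opprK subrr.
  rewrite -[RHS](sum_chi_degenerate b1 (a1 * 2) b2); apply: eq_bigr => z _.
  congr (chi _); rewrite q1E q2E.
  by field; rewrite ?nz.
case: (eqVneq Y (- 1)) => [->|YN1].
  rewrite sqrrN expr1n [X in cubic_sum X]subrr cubic_sum0 k2.
  rewrite [- - chi _]opprK [RHS]subrr.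
  rewrite -[RHS](sum_chi_degenerate b2 (a2 * 2) b1); apply: eq_bigr => z _.
  congr (chi _); rewrite q1E q2E.
  by field; rewrite ?nz.
set y := 1 + Y; set x := 1 - Y.
have y0 : y != 0 by rewrite /y addrC addr_eq0.
have x0 : x != 0 by rewrite /x subr_eq0 eq_sym.
under eq_bigr do rewrite q1E q2E.
rewrite (sum_chi_quadratic2 two_neq0 b1_neq0); first last.
(* If [q2 = m q1] identically in [z], the outer coefficients force [x ^+ 2 = y ^+ 2], so [Y = 0];
   then [a1 * b2 - a2 * b1 = 4 * t * s] would vanish. *)
- move=> m; apply/negPn; rewrite !negb_or !negbK !subr_eq0.
  apply/negP => /and3P[/eqP mb /eqP ma /eqP mc].
  have xy : x ^+ 2 = y ^+ 2.
    apply: (mulfI b2_neq0); rewrite {2}mb.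
    have -> : b2 * x ^+ 2 = 8 * (b2 / 8 * x ^+ 2) by field; rewrite ?nz.
    by rewrite mc; field; rewrite ?nz.
  have Y0 : Y = 0.
    apply: (mulfI two_neq0); apply: (mulfI two_neq0).
    have -> : 2 * (2 * Y) = y ^+ 2 - x ^+ 2 by rewrite /x /y; ring.
    by rewrite xy subrr !mulr0.
  move: ma; rewrite /x /y Y0 subr0 addr0 !mulr1 => ma.
  have : 2 ^+ 2 * t * s = a2 * b1 * - 1 + a1 * b2.
    by rewrite /a2 /a1 /b1 /b2; ring.
  rewrite ma mb; set u := RHS; have -> : u = 0 by rewrite /u; ring.
  by apply/eqP; rewrite !mulf_neq0 ?expf_neq0 ?s_neq0.
- by move=> z; rewrite -q1E q1_neq0.
congr (_ - _).
pose p := 1 - Y ^+ 2; pose q := 1 - (k ^+ 2 - Y ^+ 2).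
have pE : p = x * y by rewrite /p /x /y; ring.
have p0 : p != 0 by rewrite pE mulf_neq0.
(* As a quadratic in [m], the discriminant of [q2 - m q1] has outer coefficients
   [d ^+ 2 * y ^+ 2 / 2] and [d ^+ 2 * x ^+ 2 / 2]. Scaling [m] by [x / y] makes it proportional to
   the reciprocal [m ^+ 2 - e * m + 1]. *)
pose e := 2 - 4 * q / p.
have xy0 : x / y != 0 by rewrite mulf_neq0 ?invr_eq0.
rewrite (reindex_inj (mulfI xy0)) /=.
transitivity (- \sum_m chi p * chi (m * (m ^+ 2 - e * m + 1))).
  rewrite -sumrN; apply: eq_bigr => m _.
  (* The constant pulled out is [2 * p] times the square of this element; [chi 2] gives the sign. *)
  have c0 : x * d / (2 * y) != 0 by rewrite !mulf_neq0 ?invr_eq0 ?mulf_neq0.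
  rewrite -[RHS]mulN1r -chi2 -!(chiM two_neq0).
  rewrite -[RHS](chi_mul_sqr two_neq0 _ c0); congr (chi _).
  rewrite /e pE /q /k /a1 /b1 /a2 /b2 /s.
  have sE : d = t ^+ 2 - 2 by [].
  rewrite sE in d0 *.
  have xE : x = 1 - Y by [].
  have yE : y = 1 + Y by [].
  rewrite xE yE in x0 y0 *.
  by field; rewrite x0 y0 d0 ?nz.
congr (- _); rewrite -mulr_sumr (sum_chi_reciprocal two_neq0) mulr_sumr.
(* For [n = 4 / p * m + 2] the factors [n - 2], [n + 2], [n - e] become [4 / p] times [m], [m + p],
   [m + q]. *)
have p40 : 4 / p != 0.
  by rewrite mulf_neq0 ?invr_eq0 ?nz.
rewrite (reindex_inj (addIr 2)) (reindex_inj (mulfI p40)).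
apply: eq_bigr => m _; rewrite -(chiM two_neq0).
have p80 : 8 / p != 0.
  by rewrite mulf_neq0 ?invr_eq0 ?nz.
rewrite -[RHS](chi_mul_sqr two_neq0 _ p80); congr (chi _).
by rewrite /e -/p -/q; field; rewrite ?nz.
Qed.

Lemma sum_chi_surface :
  \sum_Y \sum_z chi (q1 t (1 + Y) z * q2 t (1 - Y) z * q3 t (1 - Y) (1 + Y))
  = 0.
Proof.
pose g v := - cubic_sum (1 - v) (1 - (k ^+ 2 - v)) - chi (b1 * b2).
have d0 := d_neq0.
transitivity (\sum_Y chi (2 * d) * (chi (k + Y) * g (Y ^+ 2))).
  apply: eq_bigr => Y _; rewrite /g -sum_chi_q1q2 mulrA mulr_sumr.
  apply: eq_bigr => z _; rewrite -!(chiM two_neq0) mulrC; congr (chi (_ * _)).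
  by rewrite /q3 /k /s; move: d0; rewrite /d => d0; field; rewrite ?nz.
rewrite -mulr_sumr (sum_chi_circle two_neq0) ?mulr0 //; first exact: chi2.
  by rewrite mulf_neq0 ?invr_eq0 ?s_neq0.
by move=> v; rewrite /g cubic_sumC subKr.
Qed.

End Surface.

Unset Implicit Arguments.

Theorem theorem6p3 (F : finFieldType)
  (char_neq2 : 2%N \notin [pchar F]) (char_neq3 : 3%N \notin [pchar F])
  (two_nonsquare : ~ exists a : F, a ^+ 2 = 2)
  (t : F) (t_neq0 : t != 0) (t2_neqN2 : t ^+ 2 != - 2) :
  #|V_points t| = (#|F| ^ 2 + #|F| + 1)%N.
Proof.
have two_neq0 : 2 != 0 :> F.
  by apply: contraNneq char_neq2 => two0; rewrite inE /= two0.
pose f x y z := q1 t y z * q2 t x z * q3 t x y.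
have f_homogeneous l x y z : f (l * x) (l * y) (l * z) = l ^+ 6 * f x y z.
  by rewrite /f /q1 /q2 /q3; ring.
have fN x z : f x (- x) z = 0 by rewrite /f /q3 subrr mul0r mulr0.
have q_gt1 : (1 < #|F|)%N.
  by apply/card_gt1P; exists 0, 1; split=> //; rewrite eq_sym oner_eq0.
have /eqP := card_cone two_neq0 f_homogeneous.
rewrite (sum_chi_homogeneous two_neq0 f_homogeneous fN) sum_chi_surface //.
rewrite mulr0 addr0 card_cone_orbits // -/(V_points t) => /eqP.
(* The number of points times [#|F| - 1] is [#|F| ^ 3 - 1]; cancel [#|F| - 1], which becomes [q]. *)
case: #|F| q_gt1 => // q q_gt0 /=.
nia.
Qed.
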